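(* Let $n,m,r$ be positive integers such that $rn<m<(r+1)n$, and let $\delta$ be a real number such that $0<\delta\leq 1/4$. Then for a fixed value of $r$ and sufficiently large $n$, $$P(n,m)\leq \frac{\alpha\,(r+1)}{m}+\frac{k(r)}{n^2}+O\left(\frac{1}{n^{2.5-2\delta}}\right),$$ where $k(r)=\frac{4(r+3)^4}{r^2}$ and $$\alpha=\begin{cases}1&\text{if } r+1 \text{ divides } m \text{ and } n-\frac{m}{r+1}<\frac{m}{2(r+1)(r+2)-1},\\ 0&\text{otherwise.}\end{cases}$$
   Context: For positive integers $n,m$, $P(n,m)$ denotes the proportion of permutations $g$ in the symmetric group $S_n$ on $n$ points which satisfy $g^m=1$, that is, whose order divides $m$. The asymptotic notation is for $n\to\infty$ with $r$ and $\delta$ fixed; the implied constant in $O(\cdot)$ and the threshold for ''sufficiently large $n$'' depend only on $r$ and $\delta$ (not on $m$). *)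

(* Defs.v *)
From HB Require Import structures.
From mathcomp Require Import all_boot all_order all_algebra all_fingroup.
From mathcomp Require Import reals exp.

Set Implicit Arguments.
Unset Strict Implicit.
Unset Printing Implicit Defensive.

Import Order.TTheory GRing.Theory Num.Theory.

Local Open Scope ring_scope.

Definition perm_prop (R : realType) (n m : nat) : R :=
  #|[set g : 'S_n | (g ^+ m == 1)%g]|%:R / #|[set: 'S_n]|%:R.

Definition kcoef (R : realType) (r : nat) : R :=
  4 * (r%:R + 3) ^+ 4 / r%:R ^+ 2.

(* The quotients in the inequality are quotients of real numbers, not
   Euclidean ones. *)
Definition alpha (R : realType) (r n m : nat) : R :=
  if (r.+1 %| m)%N &&
     (n%:R - m%:R / (r%:R + 1) <
        m%:R / (2 * (r%:R + 1) * (r%:R + 2) - 1) :> R)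
  then 1 else 0.

(* Main.v *)
(** Let p(n) be the proportion of permutations all of whose cycle lengths divide m
    and tau the number of divisors of m. Marking a point gives
    n p(n) <= \sum_(d %| m) p(n - d), hence p(n) <= tau / n. Divisors of m comparable
    to n are n / A apart for some constant A, so at most one d leaves a remainder
    n - d < n / A; hence n p(n) <= 1 + A tau^2 / n. The permutations with a cycle of
    length m / (r + 1) are split off and give the alpha term, or, when alpha = 0, a
    remainder of order n to which the last bound applies. In the others the cycle
    lengths are at most m / (r + 2); the recurrence followed by the last bound then
    gives an error of order tau^3 / n^3, apart from the cycles of length m / a with
    r + 2 <= a <= (r + 1)(r + 2), the only ones that a second cycle can complete up to
    n / A points. Finally tau^6 = O(m). *)
Require Import Defs.
From mathcomp Require Import all_boot all_order all_algebra all_fingroup.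
From mathcomp Require Import reals exp.
From mathcomp Require Import cyclic.
From mathcomp Require Import zify ring lra.

Set Implicit Arguments.
Unset Strict Implicit.
Unset Printing Implicit Defensive.

Import Order.TTheory GRing.Theory Num.Theory.

(** * Permutations with prescribed cycle lengths, and their restrictions to stable sets *)

Definition cycle_perms (T : finType) (L : pred nat) : {set {perm T}} :=
  [set g | [forall x, L #|porbit g x|]].

Lemma mem_cycle_perms (T : finType) (L : pred nat) (g : {perm T}) x :
  g \in cycle_perms T L -> L #|porbit g x|.
Proof. by rewrite inE => /forallP. Qed.

Lemma card_porbit_le (n : nat) (g : 'S_n) x : #|porbit g x| <= n.
Proof. by have := max_card (porbit g x); rewrite card_ord. Qed.

(** The injection intertwines all powers of [h] and [g], so it carries each orbit of [h] onto an
    orbit of [g]. This transfers cycle lengths to restrictions. *)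
Lemma card_porbit_semiconj (T U : finType) (f : U -> T) (g : {perm T})
    (h : {perm U}) :
    injective f -> (forall u, f (h u) = g (f u)) ->
  forall u, #|porbit h u| = #|porbit g (f u)|.
Proof.
move=> f_inj fh u.
have fhX i v : f ((h ^+ i)%g v) = (g ^+ i)%g (f v).
  by elim: i v => [|i IH] v; rewrite ?expg0 ?perm1 // !expgS !permM IH fh.
rewrite -(card_imset _ f_inj); apply: eq_card => y.
apply/imsetP/porbitP => [[v /porbitP[i ->] ->] | [i ->]].
  by exists i; rewrite fhX.
by exists ((h ^+ i)%g u); rewrite ?mem_porbit ?fhX.
Qed.

Section Restriction.
Variables (T : finType) (S : {set T}).

Lemma restrict_permP (g : {perm T}) : {in S, forall x, g x \in S} ->
  exists h : 'S_#|S|, forall i, enum_val (h i) = g (enum_val i).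
Proof.
move=> gS; pose f (i : 'I_#|S|) := enum_rank_in (enum_valP i) (g (enum_val i)).
have fE i : enum_val (f i) = g (enum_val i).
  by rewrite enum_rankK_in // gS // enum_valP.
have f_inj : injective f.
  move=> i j eq_f; apply: enum_val_inj; apply: (@perm_inj _ g).
  by rewrite -!fE eq_f.
by exists (perm f_inj) => i; rewrite permE.
Qed.

(* The identity if [g] does not preserve [S]. *)
Definition restrict_perm (g : {perm T}) : 'S_#|S| :=
  odflt 1%g [pick h : 'S_#|S| | [forall i, enum_val (h i) == g (enum_val i)]].

Lemma restrict_permE (g : {perm T}) : {in S, forall x, g x \in S} ->
  forall i, enum_val (restrict_perm g i) = g (enum_val i).
Proof.
move=> gS; rewrite /restrict_perm; case: pickP => [h /forallP hE i|no_h].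
  exact/eqP.
have [h hE] := restrict_permP gS.
by have /negP[] := no_h h; apply/forallP => i; apply/eqP.
Qed.

End Restriction.

(** * Counting permutations with a marked point *)

(** A permutation with a marked point on a [d]-cycle is determined by the injective [d]-tuple
    listing this cycle from the point on, and by its restriction to the other [n - d] points. *)
Lemma card_perms_marked_cycle (n d : nat) (L : pred nat) :
  \sum_(g in cycle_perms 'I_n L) #|[set x | #|porbit g x| == d]|
    <= n ^_ d * #|cycle_perms 'I_(n - d) L|.
Proof.
pose A := [set u : 'S_n * 'I_n |
             (u.1 \in cycle_perms _ L) && (#|porbit u.1 u.2| == d)].
pose phi (u : 'S_n * 'I_n) : d.-tuple 'I_n :=
  Tuple (introT eqP (size_traject u.1 u.2 d)).
pose Q := [set t : d.-tuple 'I_n | all predT t & uniq t].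
have -> : \sum_(g in cycle_perms 'I_n L) #|[set x | #|porbit g x| == d]| = #|A|.
  rewrite -sum1_card; under eq_bigr => g _ do rewrite -sum1_card.
  by rewrite pair_big_dep /=; apply: eq_bigl => -[g x] /=; rewrite !inE.
have phiQ u : u \in A -> phi u \in Q.
  rewrite !inE => /andP[_ /eqP du]; rewrite all_predT /= -du.
  exact: uniq_traject_porbit.
rewrite -sum1_card (partition_big phi (mem Q)) //=.
have -> : n ^_ d = \sum_(t in Q) 1.
  by rewrite sum1_card card_uniq_tuples card_ord.
rewrite big_distrl /=; apply: leq_sum => t; rewrite inE => /andP[_ Ut].
rewrite mul1n sum1_card.
pose S := ~: [set x in t].
have cardS : #|S| = n - d.
  rewrite cardsCs setCK card_ord; congr (_ - _).
  by rewrite cardsE (card_uniqP Ut) size_tuple.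
have stab g x : #|porbit g x| = d -> phi (g, x) = t ->
    {in S, forall y, g y \in S}.
  move=> dgx tE y; have inS z : (z \in S) = (z \notin porbit g x).
    by rewrite !inE -tE porbit_traject dgx.
  rewrite !inS; apply: contra.
  by rewrite -!eq_porbit_mem -{2}(expg1 g) porbit_perm.
(* For a fixed tuple [t], restriction to the complement [S] is injective and keeps all cycle lengths
   in [L]. *)
rewrite -cardS -(card_in_imset (f := fun u => restrict_perm S u.1)).
  apply/subset_leq_card/subsetP => h /imsetP[[g x]].
  case/andP; rewrite inE /= => /andP[gL /eqP dgx] /eqP tE ->.
  rewrite inE; apply/forallP => i.
  rewrite (card_porbit_semiconj enum_val_inj (restrict_permE (stab _ _ dgx tE))).
  exact: mem_cycle_perms.
move=> [g x] [g' x'] /andP[]; rewrite inE /= => /andP[gL /eqP dgx] /eqP tE.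
move=> /andP[]; rewrite inE /= => /andP[gL' /eqP dgx'] /eqP tE' eqh.
have eqt : traject g x d = traject g' x' d.
  exact: (congr1 (@tval d 'I_n) (etrans tE (esym tE'))).
have d_gt0 : 0 < d by rewrite -dgx lt0n card_porbit_neq0.
have eq_it k : k < d -> iter k g x = iter k g' x'.
  move=> lt_kd; rewrite -(nth_traject g lt_kd) eqt.
  by rewrite (set_nth_default x') ?size_traject // nth_traject.
have eq_x : x = x' by apply: (eq_it 0).
congr pair => //; apply/permP => y.
have [yS|] := boolP (y \in S).
  rewrite -(enum_rankK_in yS yS) -(restrict_permE (stab _ _ dgx tE)).
  by rewrite -(restrict_permE (stab _ _ dgx' tE')) eqh.
(* Off [S] both permutations step along the tuple; its last entry returns to the marked point. *)
rewrite !inE negbK -tE /= => /trajectP[k lt_kd ->].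
rewrite {2}eq_it // -!iterS.
have [lt_k1d|] := ltnP k.+1 d; first exact: eq_it.
rewrite leq_eqVlt ltnNge lt_kd orbF => /eqP <-.
by rewrite -{1}dgx -{1}dgx' !iter_porbit.
Qed.

(** Pairs of a permutation and a point are sorted by the length of the cycle through the point. *)
Lemma cycle_perms_recurrence (n : nat) (L : pred nat) :
  n * #|cycle_perms 'I_n L|
    <= \sum_(d < n.+1 | L d) n ^_ d * #|cycle_perms 'I_(n - d) L|.
Proof.
have le_sum : \sum_(d < n.+1 | L d)
    \sum_(g in cycle_perms 'I_n L) #|[set x | #|porbit g x| == d]|
      <= \sum_(d < n.+1 | L d) n ^_ d * #|cycle_perms 'I_(n - d) L|.
  by apply: leq_sum => d _; apply: card_perms_marked_cycle.
apply: leq_trans le_sum.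
rewrite exchange_big /= mulnC -sum_nat_const; apply: leq_sum => g gL.
rewrite -{1}(card_ord n) -sum1_card.
(* Orbit lengths are at most [n], so [inord] never takes its default value. *)
rewrite (partition_big (fun x => inord #|porbit g x| : 'I_n.+1) (fun d => L d)).
  apply: leq_sum => d _; rewrite sum1_card.
  apply/subset_leq_card/subsetP => x; rewrite !inE => /eqP <-.
  by rewrite /= inordK // ltnS card_porbit_le.
by move=> x _; rewrite inordK ?ltnS ?card_porbit_le ?mem_cycle_perms.
Qed.

(** One [d]-cycle already supplies [d] points that can be marked. *)
Lemma card_perms_with_cycle (n d : nat) (L : pred nat) :
  d * #|[set g in cycle_perms 'I_n L | [exists x, #|porbit g x| == d]]|
    <= n ^_ d * #|cycle_perms 'I_(n - d) L|.
Proof.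
apply: leq_trans (card_perms_marked_cycle n d L).
rewrite mulnC -sum_nat_const big_mkcond [leqRHS]big_mkcond /=.
apply: leq_sum => g _; rewrite inE; case: (g \in _) => //=.
case: existsP => // -[x /eqP <-]; apply/subset_leq_card/subsetP => y.
by rewrite inE -eq_porbit_mem => /eqP ->.
Qed.

Lemma expg_eq1_sub_cycle_perms (n m : nat) :
  [set g : 'S_n | (g ^+ m == 1)%g]
    \subset cycle_perms 'I_n [pred d | (d %| m) && (d <= n)].
Proof.
apply/subsetP => g; rewrite !inE -order_dvdn => gm; apply/forallP => x /=.
rewrite card_porbit_le andbT; apply: dvdn_trans gm.
by rewrite porbitE dvdn_orbit.
Qed.

(** * The sixth power of the number of divisors *)

(** A divisor [d] of [a * b] is the product of [gcdn d a], which divides [a], and [d %/ gcdn d a],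
    which is coprime to [a %/ gcdn d a] and hence divides [b]. *)
Lemma size_divisorsM (a b : nat) : 0 < a -> 0 < b ->
  size (divisors (a * b)) <= size (divisors a) * size (divisors b).
Proof.
move=> a_gt0 b_gt0; rewrite -(size_allpairs muln).
apply: uniq_leq_size (divisors_uniq _) _ => d.
rewrite -dvdn_divisors ?muln_gt0 ?a_gt0 // => d_ab.
apply/allpairsP; exists (gcdn d a, d %/ gcdn d a) => /=; split.
- by rewrite -dvdn_divisors // dvdn_gcdr.
- rewrite -dvdn_divisors // -(@Gauss_dvdr _ (a %/ gcdn d a)).
    rewrite -(@dvdn_pmul2r (gcdn d a)) ?gcdn_gt0 ?a_gt0 ?orbT //.
    by rewrite divnK ?dvdn_gcdl // mulnAC divnK ?dvdn_gcdr.
  rewrite /coprime -(eqn_pmul2r (m := gcdn d a)) ?gcdn_gt0 ?a_gt0 ?orbT //.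
  by rewrite muln_gcdl !divnK ?dvdn_gcdl ?dvdn_gcdr // mul1n.
- by rewrite mulnC divnK ?dvdn_gcdl.
Qed.

Lemma size_divisors_pfactor (p e : nat) : prime p ->
  size (divisors (p ^ e)) <= e.+1.
Proof.
move=> p_pr; rewrite -(size_mkseq (expn p) e.+1).
apply: uniq_leq_size (divisors_uniq _) _ => d.
rewrite -dvdn_divisors ?expn_gt0 ?prime_gt0 // => /(dvdn_pfactor _ _ p_pr)[k le_ke ->].
by apply/mapP; exists k; rewrite ?mem_iota.
Qed.

(** Sixth power of [e.+1 <= 6 * (e %/ 6).+1 <= 6 * 2 ^ (e %/ 6)]. *)
Lemma succn_exp6_leq e : e.+1 ^ 6 <= 6 ^ 6 * 2 ^ e.
Proof.
have le_e : e.+1 <= 6 * 2 ^ (e %/ 6).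
  apply: leq_trans (leq_mul (leqnn 6) (ltn_expl _ (isT : 1 < 2))).
  by rewrite {1}(divn_eq e 6); have := ltn_pmod e (isT : 0 < 6); lia.
have := leq_exp2r e.+1 (6 * 2 ^ (e %/ 6)) (isT : 0 < 6); rewrite le_e => le6.
apply: leq_trans le6 _; rewrite expnMn -expnM leq_mul2l leq_exp2l //.
by rewrite leq_trunc_div orbT.
Qed.

(* Only the primes below [64 = 2 ^ 6] cost a constant factor. *)
Lemma size_divisors_exp6 :
  exists K : nat, forall m, 0 < m -> size (divisors m) ^ 6 <= K * m.
Proof.
exists ((6 ^ 6) ^ 64) => m m_gt0.
(* Induction on a strict bound [k] for the primes dividing [a]; each step splits off the [k]-part,
   and the constant stops growing at [k = 64]. *)
suff H k a : 0 < a -> (forall p, prime p -> p %| a -> p < k) ->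
    size (divisors a) ^ 6 <= (6 ^ 6) ^ minn k 64 * a.
  apply: leq_trans (H m.+1 m m_gt0 _) _.
    by move=> p _ p_m; rewrite ltnS dvdn_leq.
  by rewrite leq_mul2r leq_exp2l // geq_minr orbT.
elim: k a => [|k IH] a a_gt0 a_lt.
  suff -> : a = 1 by [].
  apply/eqP; rewrite eqn_leq a_gt0 andbT leqNgt; apply/negP => a_gt1.
  by have := a_lt _ (pdiv_prime a_gt1) (pdiv_dvd a).
have ak_gt0 : 0 < a`_k^' by rewrite part_gt0.
have le_ak : size (divisors a`_k^') ^ 6 <= (6 ^ 6) ^ minn k 64 * a`_k^'.
  apply: IH => // p p_pr p_ak.
  have := a_lt p p_pr (dvdn_trans p_ak (dvdn_part _ _)).
  rewrite ltnS leq_eqVlt => /predU1P[eq_pk|//].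
  have := part_pnat k^' a; rewrite /pnat => /andP[_ /allP/(_ p)].
  by rewrite mem_primes p_pr ak_gt0 p_ak => /(_ isT); rewrite inE /= eq_pk inE eqxx.
suff le_k : size (divisors a`_k) ^ 6 <= (6 ^ 6) ^ (minn k.+1 64 - minn k 64) * a`_k.
  rewrite -(partnC k a_gt0).
  have := size_divisorsM (part_gt0 k a) ak_gt0.
  rewrite -(leq_exp2r _ _ (isT : 0 < 6)) => /leq_trans -> //.
  rewrite expnMn -(@subnK (minn k 64) (minn k.+1 64)); last by lia.
  by rewrite expnD mulnACA leq_mul.
have [k_pr|k_npr] := boolP (prime k); last first.
  by rewrite p_part lognE (negPf k_npr) /= muln1 expn_gt0.
rewrite p_part; set e := logn k a.
have := size_divisors_pfactor e k_pr.
rewrite -(leq_exp2r _ _ (isT : 0 < 6)) => /leq_trans -> //.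
have [k_lt|k_ge] := ltnP k 64.
  have -> : minn k.+1 64 - k = 1 by lia.
  apply: leq_trans (succn_exp6_leq e) _.
  rewrite expn1 leq_mul2l; apply/orP; right.
  case: (e) => // e'; rewrite leq_exp2r //; exact: prime_gt1.
(* For [k >= 64], [e.+1 ^ 6 <= (2 ^ e) ^ 6 = 64 ^ e <= k ^ e], without a constant. *)
have -> : minn k.+1 64 - 64 = 0 by lia.
rewrite expn0 mul1n; have := ltn_expl e (isT : 1 < 2).
rewrite -(leq_exp2r _ _ (isT : 0 < 6)) => /leq_trans -> //.
rewrite -expnM mulnC expnM; case: (e) => // e'.
by rewrite leq_exp2r.
Qed.

(** * Proportions of permutations with prescribed cycle lengths *)

Local Open Scope ring_scope.

Definition cycle_prob (R : realFieldType) (L : pred nat) (n : nat) : R :=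
  #|cycle_perms 'I_n L|%:R / n`!%:R.

Section Probability.
Variable R : realFieldType.
Implicit Types (L : pred nat) (n d m : nat).

Let fact_pos n : 0 < n`!%:R :> R.
Proof. by rewrite ltr0n fact_gt0. Qed.

Lemma cycle_prob_ge0 L n : 0 <= cycle_prob R L n.
Proof. by rewrite divr_ge0. Qed.

Lemma cycle_prob_le1 L n : cycle_prob R L n <= 1.
Proof.
by rewrite ler_pdivrMr // mul1r ler_nat -card_Sn max_card.
Qed.

(** Turns the counting inequalities into inequalities between proportions: the falling factorial is
    the quotient of the two factorials. *)
Lemma ffact_cycle_prob L n d : (d <= n)%N ->
  (n ^_ d * #|cycle_perms 'I_(n - d) L|)%N%:R
    = n`!%:R * cycle_prob R L (n - d).
Proof.
move=> le_dn; rewrite -(ffact_fact le_dn) !natrM /cycle_prob -mulrA; congr (_ * _).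
by rewrite mulrCA divff ?mulr1 ?gt_eqF.
Qed.

Lemma cycle_prob_recurrence L n :
  n%:R * cycle_prob R L n <= \sum_(d < n.+1 | L d) cycle_prob R L (n - d).
Proof.
rewrite mulrA ler_pdivrMr // mulrC mulr_suml mulrC -natrM.
have := cycle_perms_recurrence n L; rewrite -(ler_nat R) => /le_trans -> //.
rewrite natr_sum; apply: ler_sum => d _.
by rewrite ffact_cycle_prob ?leq_ord // mulrC.
Qed.

Lemma perm_prop_le_cycle_prob (S : realType) n m :
  perm_prop S n m <= cycle_prob S [pred d | (d %| m)%N && (d <= n)%N] n.
Proof.
rewrite /perm_prop cardsT card_Sn ler_pM2r ?invr_gt0 ?ltr0n ?fact_gt0 //.
by rewrite ler_nat subset_leq_card // expg_eq1_sub_cycle_perms.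
Qed.

(** Either no cycle has length [d], or [card_perms_with_cycle] applies. *)
Lemma cycle_prob_split L n d : (0 < d <= n)%N ->
  cycle_prob R L n
    <= cycle_prob R [pred e | L e && (e != d)] n + cycle_prob R L (n - d) / d%:R.
Proof.
case/andP=> d_gt0 le_dn.
pose A := cycle_perms 'I_n L; pose A' := cycle_perms 'I_n [pred e | L e && (e != d)].
pose B := [set g in A | [exists x, #|porbit g x| == d]].
have le_A : (#|A| <= #|A'| + #|B|)%N.
  apply: (@leq_trans #|A' :|: B|); last by rewrite cardsU leq_subr.
  apply/subset_leq_card/subsetP => g gA; rewrite in_setU /B inE gA /=.
  case: (boolP [exists x, #|porbit g x| == d]) => [_|/existsPn no_d].
    by rewrite orbT.
  rewrite orbF inE; apply/forallP => x /=.
  by rewrite (mem_cycle_perms _ gA) no_d.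
have le_B : #|B|%:R / n`!%:R <= cycle_prob R L (n - d) / d%:R.
  rewrite ler_pdivrMr // mulrAC ler_pdivlMr ?ltr0n // -natrM mulnC.
  by rewrite [leRHS]mulrC -ffact_cycle_prob // ler_nat card_perms_with_cycle.
apply: le_trans (lerD (lexx _) le_B).
by rewrite -mulrDl ler_pM2r ?invr_gt0 // -natrD ler_nat.
Qed.

End Probability.

(** * Divisors as cycle lengths: counting, first bounds, separation *)

Lemma sumr_le_card (R : realFieldType) (I : finType) (Q : pred I) (F : I -> R)
    (c : R) (k : nat) :
    (#|[pred i | Q i]| <= k)%N -> 0 <= c -> (forall i, Q i -> F i <= c) ->
  \sum_(i | Q i) F i <= k%:R * c.
Proof.
move=> le_k c_ge0 Fc; apply: le_trans (ler_sum _ Fc) _.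
by rewrite sumr_const -[leLHS]mulr_natl ler_wpM2r // ler_nat.
Qed.

Lemma card_ord_le_size (N : nat) (Q : pred nat) (s : seq nat) :
  (forall d, Q d -> d \in s) -> (#|[pred d : 'I_N | Q d]| <= size s)%N.
Proof.
move=> Qs; rewrite cardE -(size_map val); apply: uniq_leq_size.
  by rewrite map_inj_uniq ?enum_uniq //; apply: val_inj.
by move=> e /mapP[d]; rewrite mem_enum => Qd ->; apply: Qs.
Qed.

(** A divisor is determined by its codivisor [m %/ d], here confined to [k] consecutive values. *)
Lemma card_codivisors (N m a k : nat) (Q : pred nat) : (0 < m)%N ->
    (forall d, Q d -> (d %| m)%N && (a <= m %/ d < a + k)%N) ->
  (#|[pred d : 'I_N | Q d]| <= k)%N.
Proof.
move=> m_gt0 Qa; rewrite -(size_iota a k) -(size_map (fun e => (m %/ e)%N)).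
apply: card_ord_le_size => d /Qa/andP[d_m a_d]; apply/mapP.
exists (m %/ d)%N; rewrite ?mem_iota //.
by have /dvdnP[e me] := d_m; rewrite me in m_gt0 *; rewrite mulnK ?mulKn; lia.
Qed.

Section DivisorCycles.
Variables (R : realFieldType) (m : nat) (L : pred nat).
Hypothesis m_gt0 : (0 < m)%N.
Hypothesis L_dvd : forall d, L d -> (d %| m)%N.

Local Notation p := (cycle_prob R L).
Local Notation tau := (size (divisors m)).

Lemma card_divisors_ord N : (#|[pred d : 'I_N | L d]| <= tau)%N.
Proof. by apply: card_ord_le_size => d /L_dvd; rewrite -dvdn_divisors. Qed.

(** The recurrence has at most [tau] terms, each at most 1. *)
Lemma cycle_prob_le_tau t : t%:R * p t <= tau%:R.
Proof.
apply: le_trans (cycle_prob_recurrence R L t) _; rewrite -[tau%:R]mulr1.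
by apply: sumr_le_card => [||d _]; rewrite ?card_divisors_ord ?cycle_prob_le1.
Qed.

(** In the recurrence, terms with [t - d < n / A] are bounded by 1; each of the at most [tau] others
    is bounded by [tau / (t - d) <= A * tau / n]. *)
Lemma cycle_prob_near n A t : (0 < n)%N ->
  t%:R * p t <= #|[pred d : 'I_t.+1 | L d && ((t - d) * A < n)%N]|%:R
                + A%:R * tau%:R ^+ 2 / n%:R.
Proof.
move=> n_gt0; have n_pos : 0 < n%:R :> R by rewrite ltr0n.
apply: le_trans (cycle_prob_recurrence R L t) _.
rewrite (bigID (fun d : 'I_t.+1 => ((t - d) * A < n)%N)) /=; apply: lerD.
  rewrite -[leRHS]mulr1; apply: sumr_le_card => // d _.
  exact: cycle_prob_le1.
have -> : A%:R * tau%:R ^+ 2 / n%:R = tau%:R * (A%:R * tau%:R / n%:R) :> R.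
  by field; rewrite gt_eqF.
apply: sumr_le_card => [||d /andP[_]].
- apply: leq_trans (card_divisors_ord t.+1); apply/subset_leq_card/subsetP => d.
  by rewrite !inE => /andP[].
- by rewrite divr_ge0 ?mulr_ge0.
rewrite -leqNgt => le_n; rewrite ler_pdivlMr //.
have := cycle_prob_le_tau (t - d); set q := p (t - d) => le_tau.
have q_ge0 : 0 <= q by apply: cycle_prob_ge0.
apply: (@le_trans _ _ (q * ((t - d) * A)%N%:R)).
  by rewrite ler_wpM2l // ler_nat.
by rewrite natrM mulrA [q * _]mulrC [leRHS]mulrC ler_wpM2r.
Qed.

End DivisorCycles.

(* Two distinct divisors of [m] of order [n] are at distance of order [n], because
   their codivisors are bounded. *)
Lemma divisors_separated (r M n m t d e : nat) :
    (n <= m < r.+1 * n)%N -> (n <= 2 * M * t)%N ->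
    (d %| m)%N -> (e %| m)%N -> (d < e <= t)%N ->
  (n <= (t - d) * (4 * M * r.+1) ^ 2)%N.
Proof.
case/andP=> le_nm lt_mn le_nt /dvdnP[a ma] /dvdnP[b mb] /andP[lt_de le_et].
have [B BE] : {B | B = 4 * M * r.+1}%N by exists (4 * M * r.+1)%N.
have [q tE] : {q | t = d + q}%N by exists (t - d)%N; lia.
(* Suppose [q * B ^ 2 < n]. Then [d > n / (4 * M)], so the codivisor [a] of [d] is below [B]. From
   [b < a] follows [d * b.+1 <= d * a = e * b], so [d <= (e - d) * b <= q * B] and
   [m = a * d <= q * B ^ 2 < n], a contradiction. *)
rewrite -BE tE addKn leqNgt; apply/negP => near; rewrite {}tE in le_nt le_et.
have n_gt0 : (0 < n)%N by lia.
have M_gt0 : (0 < M)%N by nia.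
have B_ge : (4 * M <= B)%N by rewrite BE; nia.
have q4 : (q * (4 * M) <= q * B ^ 2)%N.
  by rewrite leq_mul2l; apply/orP; right; nia.
have lt_nd : (n < 4 * M * d)%N by nia.
have d_gt0 : (0 < d)%N by nia.
have lt_aB : (a < B)%N.
  have EB : (B * d = r.+1 * (4 * M * d))%N by rewrite BE; ring.
  rewrite -(ltn_pmul2r d_gt0) -ma (leq_trans lt_mn) // EB.
  by rewrite leq_mul2l ltnW ?orbT.
have lt_ba : (b < a)%N.
  rewrite ltnNge; apply/negP => le_ab.
  have b_gt0 : (0 < b)%N by rewrite lt0n; apply/eqP => b0; rewrite b0 mul0n in mb; lia.
  have : (a * d < b * e)%N.
    by apply: leq_ltn_trans (leq_mul le_ab (leqnn d)) _; rewrite ltn_pmul2l.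
  by rewrite -ma -mb ltnn.
have le_d : (d <= (e - d) * b)%N.
  have := leq_mul lt_ba (leqnn d); rewrite -ma mulSn mb mulnBl (mulnC e) (mulnC d).
  by lia.
have le_dq : (d <= q * B)%N.
  by apply: leq_trans le_d _; apply: leq_mul; lia.
have : (m <= q * B ^ 2)%N.
  by rewrite ma -mulnn mulnA mulnC; apply: leq_mul => //; apply: ltnW.
by lia.
Qed.

(** Since [1 / (r + 1) - 1 / (r + 2) = 1 / M > 1 / (M + 1)], lengths [d] and [e] cannot fill
    [n > m / (r + 1)] points; [EM] shows that at least [n / ((r + 2) (M + 1))] points remain. *)
Lemma complement_far (r n m d e : nat) : (m < r.+1 * n)%N ->
    (d * r.+2 <= m)%N -> (e * (r.+1 * r.+2).+1 <= m)%N -> (d + e <= n)%N ->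
  (n <= (n - e - d) * (4 * (r.+1 * r.+2) * r.+1) ^ 2)%N.
Proof.
move=> lt_mn le_d le_e le_n; set M := (r.+1 * r.+2)%N.
have -> : (n - e - d = n - (d + e))%N by lia.
have M_ge : (r.+2 <= M)%N by rewrite /M; nia.
have le_B : (r.+2 * M.+1 <= (4 * M * r.+1) ^ 2)%N.
  apply: (@leq_trans (M * (2 * M))); first by apply: leq_mul => //; nia.
  by rewrite -mulnn; apply: leq_mul; nia.
apply: leq_trans (leq_mul (leqnn _) le_B).
have : (d * r.+2 * M.+1 <= m * M.+1)%N by rewrite leq_mul2r le_d orbT.
have : (e * M.+1 * r.+2 <= m * r.+2)%N by rewrite leq_mul2r le_e orbT.
have : (m * (r.+2 + M.+1) <= r.+1 * n * (r.+2 + M.+1))%N.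
  by rewrite leq_mul2r ltnW ?orbT.
have EM : (r.+1 * (r.+2 + M.+1) + 1 = r.+2 * M.+1)%N by rewrite /M; lia.
have : (r.+1 * n * (r.+2 + M.+1) + n = n * (r.+2 * M.+1))%N by rewrite -EM; lia.
rewrite mulnBl; lia.
Qed.

(** * Estimates when [m] is comparable to [n] *)

Section Estimates.
Variables (R : realFieldType) (r n m : nat) (L : pred nat).
Hypothesis n_gt0 : (0 < n)%N.
Hypothesis le_nm : (n <= m)%N.
Hypothesis lt_mn : (m < r.+1 * n)%N.
Hypothesis L_dvd : forall d, L d -> (d %| m)%N.

Let M := (r.+1 * r.+2)%N.
(** The separation constant common to [divisors_separated] and [complement_far]. *)
Let A := ((4 * M * r.+1) ^ 2)%N.
Let n_pos : 0 < n%:R :> R. Proof. by rewrite ltr0n. Qed.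
Let m_gt0 : (0 < m)%N. Proof. exact: leq_trans le_nm. Qed.

Local Notation p := (cycle_prob R L).
Local Notation tau := (size (divisors m)).
Local Notation err := (A%:R * tau%:R ^+ 2 / n%:R : R).

Lemma err_ge0 : 0 <= err.
Proof. by rewrite divr_ge0 ?mulr_ge0 ?exprn_ge0. Qed.

(** By [divisors_separated], at most one divisor is counted in [cycle_prob_near]. *)
Lemma cycle_prob_linear t : (n <= 2 * M * t)%N -> t%:R * p t <= 1 + err.
Proof.
move=> le_nt; apply: le_trans (cycle_prob_near R m_gt0 L_dvd A t n_gt0) _.
rewrite lerD2r (ler_nat _ _ 1); apply/card_le1_eqP => d e.
rewrite !inE => /andP[/L_dvd d_m near_d] /andP[/L_dvd e_m near_e].
have sep (u v : 'I_t.+1) : (u %| m)%N -> (v %| m)%N ->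
    ((t - u) * A < n)%N -> (v <= u)%N.
  move=> u_m v_m near_u; rewrite leqNgt; apply/negP => lt_uv.
  have := near_u; rewrite ltnNge => /negP[].
  by apply: (divisors_separated _ le_nt u_m v_m); rewrite ?le_nm // lt_uv leq_ord.
by apply/val_inj/anti_leq; rewrite !sep.
Qed.

(** By [complement_far], no divisor is counted in [cycle_prob_near]. *)
Lemma cycle_prob_far e : (forall d, L d -> (d * r.+2 <= m)%N) ->
    (e * M.+1 <= m)%N -> (e <= n)%N ->
  (n - e)%:R * p (n - e) <= err.
Proof.
move=> L_le le_e le_en.
apply: le_trans (cycle_prob_near R m_gt0 L_dvd A (n - e) n_gt0) _.
rewrite [X in X%:R + _](_ : _ = 0%N) ?add0r //.
apply: eq_card0 => d; rewrite !inE; apply/negP => /andP[/L_le le_d].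
rewrite ltnNge => /negP[]; apply: (complement_far lt_mn le_d le_e).
by have := leq_ord d; lia.
Qed.

Lemma cycle_prob_quadratic : (forall d, L d -> (d * r.+2 <= m)%N) ->
  n%:R * p n <= (r.+1 * (3 * r + 2))%:R / n%:R + tau%:R * (r.+2%:R / n%:R * err).
Proof.
move=> L_le; apply: le_trans (cycle_prob_recurrence R L n) _.
(* The terms are sorted by codivisor: up to [2 * r + 2] ([b1]), from there up to [M] ([b2]), and
   beyond [M], where [cycle_prob_far] leaves only an error. The remainder [n - d] is at least
   [n / (r + 2)] in general and [n / 2] under [b2]. *)
pose b1 d := (m <= d * (2 * r + 2))%N.
pose b2 d := ((d * (2 * r + 2) < m) && (m < d * M.+1))%N.
pose G d : R := (b1 d)%:R * (r.+2%:R / n%:R) + (b2 d)%:R * (2 / n%:R)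
                + r.+2%:R / n%:R * err.
have codiv d : L d -> [/\ (d * (m %/ d) = m)%N, (0 < d)%N & (r.+2 <= m %/ d)%N].
  move=> Ld; have dm : (d * (m %/ d) = m)%N by rewrite mulnC divnK ?L_dvd.
  have d_gt0 : (0 < d)%N by rewrite (dvdn_gt0 m_gt0) ?L_dvd.
  by split=> //; rewrite -(leq_pmul2l d_gt0) dm L_le.
have pG (d : 'I_n.+1) : L d -> p (n - d) <= G d.
  move=> Ld; have le_dn := leq_ord d; have := L_le _ Ld => le_dm.
  have le_t : (n <= (n - d) * r.+2)%N by nia.
  have t_gt0 : (0 < n - d)%N by nia.
  have t_pos : 0 < (n - d)%:R :> R by rewrite ltr0n.
  have inv_t : (n - d)%:R^-1 <= r.+2%:R / n%:R :> R.
    by rewrite ler_pdivlMr // mulrC ler_pdivrMr // -natrM ler_nat mulnC.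
  have lin : p (n - d) <= (n - d)%:R^-1 + r.+2%:R / n%:R * err.
    apply: (@le_trans _ _ ((n - d)%:R^-1 * (1 + err))).
      rewrite mulrC ler_pdivlMr // mulrC; apply: cycle_prob_linear.
      apply: leq_trans le_t _; rewrite mulnC leq_mul2r; apply/orP; right.
      by rewrite /M; nia.
    by rewrite mulrDr mulr1 lerD2l ler_wpM2r ?err_ge0.
  rewrite /G /b1 /b2; have [le_b1|lt_b1] := leqP m (d * (2 * r + 2)).
    rewrite mul1r mul0r addr0; apply: le_trans lin _.
    by rewrite lerD2r.
  have [lt_b2|le_b2] := ltnP m (d * M.+1).
    rewrite mul0r add0r mul1r; apply: le_trans lin _; rewrite lerD2r.
    rewrite ler_pdivlMr // mulrC ler_pdivrMr // -natrM ler_nat.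
    by nia.
  rewrite !mul0r !add0r; apply: (@le_trans _ _ ((n - d)%:R^-1 * err)).
    by rewrite mulrC ler_pdivlMr // mulrC cycle_prob_far.
  by rewrite ler_wpM2r ?err_ge0.
apply: le_trans (ler_sum _ pG) _; rewrite /G !big_split /=.
have sumb (b : pred nat) k c : 0 <= c ->
    (#|[pred d : 'I_n.+1 | L d && b d]| <= k)%N ->
    \sum_(d < n.+1 | L d) (b d)%:R * c <= k%:R * c :> R.
  move=> c_ge0 le_k; rewrite -mulr_suml ler_wpM2r //.
  under eq_bigr do rewrite mulrb; rewrite -big_mkcondr /=.
  apply: le_trans (sumr_le_card le_k ler01 _) _; last by rewrite mulr1.
  by move=> i.
(* The codivisors lie in [r + 2, ..., 2 * r + 2] for [b1] and in [2 * r + 3, ..., M] for [b2]. *)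
have le_b1 : (#|[pred d : 'I_n.+1 | L d && b1 d]| <= r.+1)%N.
  apply: (@card_codivisors _ m r.+2 _ (fun d => L d && b1 d)) => // d.
  case/andP=> Ld; rewrite /b1 L_dvd //.
  by case: (codiv d Ld) => dm d_gt0 ->; rewrite -{1}dm leq_pmul2l //; lia.
have le_b2 : (#|[pred d : 'I_n.+1 | L d && b2 d]| <= r.+1 * r)%N.
  apply: (@card_codivisors _ m (2 * r + 3) _ (fun d => L d && b2 d)) => // d.
  case/andP=> Ld; rewrite /b2 L_dvd //.
  by case: (codiv d Ld) => dm d_gt0 _; rewrite -{1 2}dm !ltn_pmul2l // /M; lia.
have le_tau := card_divisors_ord m_gt0 L_dvd n.+1.
apply: (@le_trans _ _ (r.+1%:R * (r.+2%:R / n%:R) + (r.+1 * r)%:R * (2 / n%:R)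
                       + tau%:R * (r.+2%:R / n%:R * err))).
  have c_ge0 k : 0 <= k%:R / n%:R :> R by rewrite divr_ge0.
  apply: lerD; first by apply: lerD; apply: sumb => //; apply: c_ge0.
  by apply: sumr_le_card => //; rewrite mulr_ge0 ?err_ge0.
(* The constant is [(r + 1) (r + 2) + 2 r (r + 1) = (r + 1) (3 r + 2)]. *)
rewrite lerD2r !mulrA -!mulrDl ler_wpM2r ?invr_ge0 ?ler0n //.
by rewrite -!natrM -natrD ler_nat; lia.
Qed.

End Estimates.

(** * The explicit bound in terms of the number of divisors *)

Lemma perm_prop_le (R : realType) (r n m : nat) :
    (0 < r)%N -> (r * n < m < r.+1 * n)%N ->
  perm_prop R n m <=
    alpha R r n m * (r%:R + 1) / m%:R + kcoef R r / n%:R ^+ 2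
    + ((2 * (r.+1 * r.+2) * r.+1 + r.+2) * (4 * (r.+1 * r.+2) * r.+1) ^ 2)%:R
      * (size (divisors m))%:R ^+ 3 / n%:R ^+ 3.
Proof.
move=> r_gt0 /andP[gt_mn lt_mn]; set M := (r.+1 * r.+2)%N.
set A := ((4 * M * r.+1) ^ 2)%N; set tau := size (divisors m).
have n_gt0 : (0 < n)%N by nia.
have le_nm : (n <= m)%N by nia.
have m_gt0 : (0 < m)%N by lia.
have n_pos : 0 < n%:R :> R by rewrite ltr0n.
have m_pos : 0 < m%:R :> R by rewrite ltr0n.
have r1_pos : 0 < r%:R + 1 :> R by rewrite natr1 ltr0n.
pose err : R := A%:R * tau%:R ^+ 2 / n%:R.
have err_pos : 0 <= err by apply: err_ge0.
pose L := [pred d | (d %| m)%N && (d <= n)%N].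
have L_dvd d : L d -> (d %| m)%N by case/andP.
(* As [d <= n < m / r], the codivisor exceeds [r]; if it is not [r + 1], it is at least [r + 2]. *)
have L_le d : L d -> (d * r.+1 != m)%N -> (d * r.+2 <= m)%N.
  case/andP=> /dvdnP[q mE] le_dn.
  have d_gt0 : (0 < d)%N.
    by rewrite lt0n; apply: contraTneq m_gt0 => d0; rewrite mE d0 muln0.
  have lt_rq : (r < q)%N.
    rewrite -(ltn_pmul2r d_gt0) -mE; apply: leq_ltn_trans gt_mn.
    by rewrite leq_mul2l le_dn orbT.
  rewrite mE mulnC eqn_pmul2r // => ne_q.
  by rewrite mulnC leq_pmul2r // ltn_neqAle ne_q.
have bulk (L' : pred nat) : (forall d, L' d -> L d && (d * r.+1 != m)%N) ->
    cycle_prob R L' n <= (r.+1 * (3 * r + 2))%:R / n%:R ^+ 2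
                         + r.+2%:R * tau%:R * err / n%:R ^+ 2.
  move=> L'L; rewrite -(ler_pM2l n_pos).
  apply: le_trans (cycle_prob_quadratic R n_gt0 le_nm lt_mn _ _) _.
  - by move=> d /L'L/andP[/L_dvd].
  - by move=> d /L'L/andP[/L_le].
  rewrite -/M -/A -/tau -/err le_eqVlt; apply/orP; left; apply/eqP.
  by field; rewrite gt_eqF.
have P_le : perm_prop R n m <= cycle_prob R L n by apply: perm_prop_le_cycle_prob.
have big : perm_prop R n m <=
    (r.+1 * (3 * r + 2))%:R / n%:R ^+ 2 + r.+2%:R * tau%:R * err / n%:R ^+ 2
    + (alpha R r n m * (r%:R + 1) / m%:R
       + (2 * M * r.+1)%:R * (1 + err) / m%:R ^+ 2).
  have rest_ge0 : 0 <= (2 * M * r.+1)%:R * (1 + err) / m%:R ^+ 2.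
    by rewrite divr_ge0 ?mulr_ge0 ?addr_ge0 ?exprn_ge0.
  have [r_dvd|r_ndvd] := boolP (r.+1 %| m)%N; last first.
    apply: le_trans P_le _; apply: le_trans (bulk L _) _.
      move=> d Ld; rewrite Ld /=; apply: contra r_ndvd => /eqP <-.
      exact: dvdn_mull.
    by rewrite lerDl addr_ge0 // /alpha (negPf r_ndvd) /= !mul0r.
  have [D mE] : {D | m = D * r.+1}%N.
    by exists (m %/ r.+1)%N; rewrite divnK.
  have D_gt0 : (0 < D)%N by nia.
  have le_Dn : (D <= n)%N by nia.
  have D_pos : 0 < D%:R :> R by rewrite ltr0n.
  apply: le_trans P_le _.
  apply: le_trans (@cycle_prob_split R L n D _) _; first by rewrite D_gt0.
  apply: lerD.
    by apply: bulk => d /= /andP[-> ne_dD] /=; rewrite mE eqn_pmul2r.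
  have invD : D%:R^-1 = (r%:R + 1) / m%:R :> R.
    rewrite mE natrM -natr1; field.
    by rewrite !gt_eqF.
  (* For [alpha = 1], [p (n - D)] is bounded by 1. Otherwise [m <= (2 * M - 1) * (n - D)], and the
     linear bound gives [p (n - D) <= 2 * M * (1 + err) / m]. *)
  rewrite invD; case alphaE: (alpha R r n m == 1).
    rewrite (eqP alphaE) mul1r -[leLHS]addr0 lerD // -[leRHS]mul1r.
    by rewrite ler_wpM2r ?cycle_prob_le1 // divr_ge0 // ltW.
  have -> : alpha R r n m = 0.
    by move: alphaE; rewrite /alpha; case: ifP; rewrite ?eqxx.
  rewrite !mul0r add0r.
  have le_mt : (m <= 2 * M * (n - D))%N.
    move: alphaE; rewrite /alpha r_dvd /=.
    case: ltP => [|le_mD _]; first by rewrite eqxx.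
    have M1_pos : 0 < 2 * (r%:R + 1) * (r%:R + 2) - 1 :> R.
      by have : 0 <= r%:R :> R := ler0n _ _; nra.
    rewrite -(ler_nat R) natrM natrB //.
    move: le_mD; rewrite ler_pdivrMr // => /le_trans; apply.
    have -> : m%:R / (r%:R + 1) = D%:R :> R.
      by rewrite mE natrM -natr1; field; rewrite gt_eqF.
    rewrite mulrC ler_wpM2r ?subr_ge0 ?ler_nat // /M !natrM -!natr1.
    by lra.
  have t_gt0 : (0 < n - D)%N by nia.
  have lin : (n - D)%:R * cycle_prob R L (n - D) <= 1 + err.
    by apply: (cycle_prob_linear R n_gt0 le_nm lt_mn L_dvd); rewrite -/M; lia.
  have t_pos : 0 < (n - D)%:R :> R by rewrite ltr0n.
  have lin' : m%:R * cycle_prob R L (n - D) <= (2 * M)%:R * (1 + err).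
    apply: (@le_trans _ _ ((2 * M)%:R * (n - D)%:R * cycle_prob R L (n - D))).
      by rewrite ler_wpM2r ?cycle_prob_ge0 // -natrM ler_nat.
    by rewrite -mulrA ler_wpM2l.
  rewrite [leRHS](_ : _ = (2 * M)%:R * (1 + err) / m%:R * ((r%:R + 1) / m%:R)).
    rewrite ler_wpM2r ?divr_ge0 ?(ltW r1_pos) // ler_pdivlMr // mulrC; exact: lin'.
  by rewrite natrM -[r.+1%:R]natr1; field; rewrite gt_eqF.
apply: le_trans big _.
have r_pos : 0 < r%:R :> R by rewrite ltr0n.
have tau_ge1 : 1 <= tau%:R :> R.
  by rewrite ler1n /tau; have := divisor1 m; case: (divisors m).
have inv_m : (m%:R ^+ 2)^-1 <= (r%:R ^+ 2 * n%:R ^+ 2)^-1 :> R.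
  rewrite lef_pV2 ?posrE ?mulr_gt0 ?exprn_gt0 // -exprMn.
  by rewrite lerXn2r ?nnegrE ?mulr_ge0 ?ler0n // -natrM ler_nat ltnW.
have inv_m' : (m%:R ^+ 2)^-1 <= (n%:R ^+ 2)^-1 :> R.
  rewrite lef_pV2 ?posrE ?exprn_gt0 //.
  by rewrite lerXn2r ?nnegrE ?ler0n // ler_nat.
(* With [m >= r * n], this reduces to [r^2 (r + 1) (3 r + 2) + 2 (r + 1)^2 (r + 2) <= 4 (r + 3)^4],
   true coefficient by coefficient. *)
have main : (r.+1 * (3 * r + 2))%:R / n%:R ^+ 2 + (2 * M * r.+1)%:R / m%:R ^+ 2
    <= kcoef R r / n%:R ^+ 2.
  apply: (@le_trans _ _ ((r.+1 * (3 * r + 2))%:R / n%:R ^+ 2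
            + (2 * M * r.+1)%:R * (r%:R ^+ 2 * n%:R ^+ 2)^-1)).
    by rewrite lerD2l ler_wpM2l.
  rewrite (invfM (r%:R ^+ 2)) [X in _ + X]mulrA -[leLHS]mulrDl.
  rewrite ler_wpM2r ?invr_ge0 ?exprn_ge0 // /kcoef.
  rewrite ler_pdivlMr ?exprn_gt0 // mulrDl divfK ?gt_eqF ?exprn_gt0 //.
  rewrite /M !natrM natrD natrM -!natr1; move: (ltW r_pos); set x := r%:R => x_ge0.
  by nra.
(* With [m >= n] and [tau >= 1], both errors become multiples of [tau * err / n ^ 2]. *)
have errs : r.+2%:R * tau%:R * err / n%:R ^+ 2
    + (2 * M * r.+1)%:R * err / m%:R ^+ 2
    <= ((2 * M * r.+1 + r.+2) * A)%:R * tau%:R ^+ 3 / n%:R ^+ 3.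
  apply: (@le_trans _ _ (r.+2%:R * tau%:R * err / n%:R ^+ 2
            + (2 * M * r.+1)%:R * (tau%:R * err) / n%:R ^+ 2)).
    rewrite lerD2l; apply: ler_pM => //.
    - by rewrite mulr_ge0.
    - by rewrite invr_ge0 exprn_ge0.
    by rewrite ler_wpM2l // ler_peMl.
  rewrite le_eqVlt; apply/orP; left; apply/eqP; rewrite /err [in RHS]natrM natrD.
  by field; rewrite gt_eqF.
rewrite mulrDr mulr1 [in leLHS]mulrDl.
by move: main errs; set a1 := _ / _; lra.
Qed.

(** * Passage to the asymptotic form *)

Theorem theorem1p2 (R : realType) (r : nat) (delta : R)
    (hr : (0 < r)%N) (hdelta0 : 0 < delta) (hdelta1 : delta <= 1 / 4) :
  exists (C : R) (N : nat), 0 < C /\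
    forall n m : nat, (0 < n)%N -> (0 < m)%N -> (N <= n)%N ->
      (r * n < m)%N -> (m < (r + 1) * n)%N ->
      perm_prop R n m <=
        alpha R r n m * (r%:R + 1) / m%:R
        + kcoef R r / n%:R ^+ 2
        + C / powR n%:R (5 / 2 - 2 * delta).
Proof.
have [K tau6] := size_divisors_exp6.
pose c := ((2 * (r.+1 * r.+2) * r.+1 + r.+2) * (4 * (r.+1 * r.+2) * r.+1) ^ 2)%N.
have c_pos : 0 < c%:R :> R by rewrite ltr0n muln_gt0 expn_gt0; lia.
(* From [tau ^ 6 <= K * m <= K.+1 * r.+1 * n], [tau ^ 3 / n ^ 3] is at most [C / c] times [n] to the
   power [-5/2]. The successor of [K] keeps [C] positive. *)
pose C : R := c%:R * Num.sqrt (K.+1 * r.+1)%:R.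
have C_pos : 0 < C by rewrite mulr_gt0 // sqrtr_gt0 ltr0n.
exists C, 0%N; split=> // n m n_gt0 m_gt0 _ gt_mn lt_mn; rewrite addn1 in lt_mn.
have n_pos : 0 < n%:R :> R by rewrite ltr0n.
apply: le_trans (perm_prop_le R hr _) _; first by rewrite gt_mn.
rewrite lerD2l -/c; set tau := size (divisors m).
have tau3 : tau%:R ^+ 3 <= Num.sqrt (K.+1 * r.+1)%:R * Num.sqrt n%:R :> R.
  rewrite -sqrtrM // -natrM -[leLHS]ger0_norm ?exprn_ge0 // -sqrtr_sqr.
  rewrite ler_sqrt // -exprM -natrX ler_nat.
  apply: leq_trans (tau6 m m_gt0) _; rewrite -mulnA.
  by apply: leq_mul => //; apply: ltnW.
have sqrt_pos : 0 < Num.sqrt n%:R :> R by rewrite sqrtr_gt0.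
(* As [n >= 1], lowering the exponent [5 / 2] by [2 * delta] can only decrease the power. *)
have le_powR : powR n%:R (5 / 2 - 2 * delta) <= n%:R ^+ 2 * Num.sqrt n%:R.
  have -> : n%:R ^+ 2 * Num.sqrt n%:R = powR n%:R (5 / 2) :> R.
    rewrite -powR12_sqrt // -powR_mulrn // -powRD; last first.
      by apply/implyP => _; rewrite gt_eqF.
    by congr powR; field.
  by apply: ler_powR; rewrite ?ler1n //; lra.
apply: (@le_trans _ _ (C / (n%:R ^+ 2 * Num.sqrt n%:R))).
  rewrite ler_pdivlMr ?mulr_gt0 ?exprn_gt0 //.
  apply: (@le_trans _ _ (c%:R * (Num.sqrt (K.+1 * r.+1)%:R * Num.sqrt n%:R)
                         / n%:R ^+ 3 * (n%:R ^+ 2 * Num.sqrt n%:R))).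
    do 2 rewrite ler_wpM2r ?mulr_ge0 ?invr_ge0 ?exprn_ge0 ?sqrtr_ge0 //.
    by rewrite ler_wpM2l.
  rewrite [leLHS](_ : _ = C * (Num.sqrt n%:R ^+ 2 / n%:R)); last first.
    by rewrite /C; field; rewrite gt_eqF.
  by rewrite sqr_sqrtr ?ler0n // divff ?mulr1 ?gt_eqF.
by rewrite ler_wpM2l ?(ltW C_pos) // lef_pV2 ?posrE ?mulr_gt0 ?exprn_gt0 ?powR_gt0.
Qed.
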